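(* Let $\{\delta_n\}_{n=0}^{\infty}$ be a real sequence with $\delta_0>0$, $|\delta_n|<1$ for $n\ge1$, and $\delta_n-\delta_{n-1}=\delta_{n-1}\delta_n$ for $n\ge2$. Put $m_0=0$ and $m_n=(1-\delta_n)/2$ for $n\ge1$. If $\mathcal{C}(z)$ is the Carathéodory function whose PPC-fraction is obtained from the minimal parameter sequence $\{m_n\}$, then the PPC-fraction obtained from the parameter sequence $\{k_n\}$, with $k_0=0$ and $k_n=1-m_n$ for $n\ge1$, corresponds to the Carathéodory function $1/\mathcal{C}(z)$.
   Context: PPC-fraction (positive Perron–Carathéodory fraction): given $r_0>0$ and $r_n\in\mathbb{C}$ with $|r_n|<1$ for $n\ge1$, it is the continued fraction $$r_0-\cfrac{2r_0}{1+\cfrac{1}{\bar r_1z+\cfrac{(1-|r_1|^2)z}{r_1+\cfrac{1}{\bar r_2z+\cfrac{(1-|r_2|^2)z}{r_2+\cdots}}}}}$$ with $n$-th numerators and denominators $\mathcal{P}_n,\mathcal{Q}_n$ given by the usual three-term recurrences for continued fractions: $\mathcal{P}_0=r_0$, $\mathcal{Q}_0=1$, $\mathcal{P}_1=-r_0$, $\mathcal{Q}_1=1$, and for $n\ge1$, $X_{2n}=\bar r_nzX_{2n-1}+X_{2n-2}$ and $X_{2n+1}=r_nX_{2n}+(1-|r_n|^2)zX_{2n-1}$ for both $X=\mathcal{P}$ and $X=\mathcal{Q}$. Then $\mathcal{Q}_{2n+1}=\Phi_n$ and $\mathcal{Q}_{2n}=\Phi_n^*$ (where $\Phi_n^*(z)=z^n\overline{\Phi_n(1/\bar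 z)}$), where $\Phi_n$ are the monic orthogonal polynomials on the unit circle with $\Phi_n(0)=r_n$. The Carathéodory function corresponding to the PPC-fraction is the function $\mathcal{C}$ analytic in $|z|<1$ with $\operatorname{Re}\mathcal{C}(z)>0$ satisfying $\mathcal{C}(z)-\mathcal{P}_{2n}(z)/\mathcal{Q}_{2n}(z)=\mathcal{O}(z^{n+1})$ as $z\to0$ for all $n$; equivalently $\mathcal{C}(z)=\int\frac{\zeta+z}{\zeta-z}\,d\mu(\zeta)$, where $\mu$ is the positive measure on the unit circle with total mass $r_0$ whose monic orthogonal polynomials satisfy $\Phi_n(0)=r_n$. The PPC-fraction obtained from a minimal parameter sequence $\{p_n\}_{n=0}^\infty$ ($p_0=0$, $0<p_n<1$ for $n\ge1$, the minimal parameter sequence of the chain sequence $\{(1-p_{n-1})p_n\}_{n\ge1}$) is the one associated with the probability measure having Verblunsky coefficients $\alpha_{n-1}=-\overline{\Phi_n(0)}=1-2p_n$, $n\ge1$; that is, $r_0=1$ and $r_n=\Phi_n(0)=-(1-2p_n)$ for $n\ge1$. *)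

(* Defs.v *)
From HB Require Import structures.
From mathcomp Require Import all_boot all_order all_algebra.
From mathcomp Require Import complex.
From mathcomp Require Import all_classical all_reals all_analysis.

Set Implicit Arguments.
Unset Strict Implicit.
Unset Printing Implicit Defensive.

Import Order.TTheory GRing.Theory Num.Theory.
Import numFieldNormedType.Exports.

Local Open Scope classical_set_scope.
Local Open Scope ring_scope.
Local Open Scope complex_scope.

(* The pair (X_{n-1}, X_n) determined by X_k = b_k X_{k-1} + a_k X_{k-2}
   (k >= 1) from the initial values X_{-1} = u and X_0 = v; a_0 and b_0 are
   not used. *)
Fixpoint cf_pair (A : nzRingType) (a b : nat -> A) (u v : A) (n : nat) : A * A :=
  if n is m.+1 then
    let X := cf_pair a b u v m in (X.2, b m.+1 * X.2 + a m.+1 * X.1)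
  else (u, v).

(* n-th numerator and denominator of b_0 + a_1/(b_1 + a_2/(b_2 + ...)). *)
Definition cf_numer (A : nzRingType) (a b : nat -> A) (n : nat) : A :=
  (cf_pair a b 1 (b 0%N) n).2.

Definition cf_denom (A : nzRingType) (a b : nat -> A) (n : nat) : A :=
  (cf_pair a b 0 1 n).2.

Section PPC.
Variable R : realType.

(* The parameters are r0 > 0 and r n for n >= 1; the value r 0 is not used. *)
Definition ppc_parameters (r0 : R) (r : nat -> R[i]) : Prop :=
  0 < r0 /\ forall n, (1 <= n)%N -> `|r n| < 1.

(* Partial numerators and denominators, as polynomials in z:
   a_1 = - 2 r0, a_{2n} = 1, a_{2n+1} = (1 - |r_n|^2) z,
   b_0 = r0,  b_1 = 1,  b_{2n} = conj(r_n) z,  b_{2n+1} = r_n  (n >= 1). *)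
Definition ppc_a (r0 : R) (r : nat -> R[i]) (n : nat) : {poly R[i]} :=
  if n == 1%N then (- (2 * r0)%:C)%:P
  else if odd n then (1 - `|r n./2| ^+ 2) *: 'X
  else 1.

Definition ppc_b (r0 : R) (r : nat -> R[i]) (n : nat) : {poly R[i]} :=
  if n == 0%N then r0%:C%:P
  else if n == 1%N then 1
  else if odd n then (r n./2)%:P
  else (r n./2)^* *: 'X.

Definition ppc_numer (r0 : R) (r : nat -> R[i]) (n : nat) : {poly R[i]} :=
  cf_numer (ppc_a r0 r) (ppc_b r0 r) n.

Definition ppc_denom (r0 : R) (r : nat -> R[i]) (n : nat) : {poly R[i]} :=
  cf_denom (ppc_a r0 r) (ppc_b r0 r) n.

Lemma ppc_initial (r0 : R) (r : nat -> R[i]) :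
  [/\ ppc_numer r0 r 0 = r0%:C%:P, ppc_denom r0 r 0 = 1,
      ppc_numer r0 r 1 = (- r0%:C)%:P & ppc_denom r0 r 1 = 1].
Proof.
rewrite /ppc_numer /ppc_denom /cf_numer /cf_denom /= /ppc_a /ppc_b /=.
split=> //; last by rewrite mulr1 mulr0 addr0.
by rewrite mul1r mulr1 -rmorphD; congr (_ %:P); rewrite mulrDl mul1r rmorphD opprD addrA subrr sub0r.
Qed.

Lemma ppc_numer_rec (r0 : R) (r : nat -> R[i]) (n : nat) : (1 <= n)%N ->
  ppc_numer r0 r n.*2 =
    (r n)^* *: 'X * ppc_numer r0 r n.*2.-1 + ppc_numer r0 r n.*2.-2 /\
  ppc_numer r0 r n.*2.+1 =
    (r n)%:P * ppc_numer r0 r n.*2 +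
    (1 - `|r n| ^+ 2) *: 'X * ppc_numer r0 r n.*2.-1.
Proof.
case: n => // n _.
by rewrite /ppc_numer /cf_numer doubleS /= /ppc_a /ppc_b /= !odd_double /= !doubleK !uphalf_double mul1r.
Qed.

Lemma ppc_denom_rec (r0 : R) (r : nat -> R[i]) (n : nat) : (1 <= n)%N ->
  ppc_denom r0 r n.*2 =
    (r n)^* *: 'X * ppc_denom r0 r n.*2.-1 + ppc_denom r0 r n.*2.-2 /\
  ppc_denom r0 r n.*2.+1 =
    (r n)%:P * ppc_denom r0 r n.*2 +
    (1 - `|r n| ^+ 2) *: 'X * ppc_denom r0 r n.*2.-1.
Proof.
case: n => // n _.
by rewrite /ppc_denom /cf_denom doubleS /= /ppc_a /ppc_b /= !odd_double /= !doubleK !uphalf_double mul1r.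
Qed.

(* Complex differentiability at every point of the open unit disk. *)
Definition analytic_in_disk (f : R[i] -> R[i]) : Prop :=
  forall z : R[i], `|z| < 1 -> derivable (f : R[i]^o -> R[i]^o) z 1.

(* Only the values of C on the open unit disk are constrained. *)
Definition caratheodory_of_ppc (r0 : R) (r : nat -> R[i]) (C : R[i] -> R[i]) :
    Prop :=
  [/\ ppc_parameters r0 r,
      analytic_in_disk C,
      (forall z : R[i], `|z| < 1 -> 0 < complex.Re (C z)) &
      forall n : nat,
        (fun z : R[i]^o =>
           C z - (ppc_numer r0 r n.*2).[z] / (ppc_denom r0 r n.*2).[z] : R[i]^o)
        =O_ (0 : R[i]^o) (fun z : R[i]^o => z ^+ n.+1 : R[i]^o)].

Definition minimal_parameters (p : nat -> R) : Prop :=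
  p 0%N = 0 /\ forall n, (1 <= n)%N -> 0 < p n < 1.

(* r_n = Phi_n(0), where the Verblunsky coefficients are
   alpha_{n-1} = - conj(Phi_n(0)) = 1 - 2 p_n. *)
Definition ppc_of_parameters (p : nat -> R) (n : nat) : R[i] :=
  (- (1 - 2 * p n))%:C.

Definition caratheodory_of_parameters (p : nat -> R) (C : R[i] -> R[i]) : Prop :=
  minimal_parameters p /\ caratheodory_of_ppc 1 (ppc_of_parameters p) C.

End PPC.

(* Main.v *)
Require Import Defs.
From HB Require Import structures.
From mathcomp Require Import all_boot all_order all_algebra.
From mathcomp Require Import complex.
From mathcomp Require Import all_classical all_reals all_analysis.
From mathcomp Require Import ring.
Import Order.TTheory GRing.Theory Num.Theory.
Import numFieldNormedType.Exports.
Local Open Scope ring_scope.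
Local Open Scope complex_scope.

(** Since [k_n = 1 - m_n], passing from [m] to [k] replaces each [r_n] by
    [- r_n].  Up to sign and the factor [r0], this exchanges the numerators and
    the denominators of the PPC-fraction, so [P_2n / Q_2n] becomes
    [Q_2n / P_2n], and
    [1/C - Q_2n/P_2n = - (Q_2n / (C P_2n)) (C - P_2n/Q_2n)] has the same order
    at [0] because [C], [P_2n] and [Q_2n] do not vanish there. *)

Lemma continuous_horner (K : numFieldType) (p : {poly K}) :
  continuous (fun z : K^o => p.[z] : K^o).
Proof.
elim/poly_ind: p => [|p c IHp] z.
  have -> : (fun z : K^o => (0 : {poly K}).[z] : K^o) = cst 0.
    by apply/funext => x; rewrite horner0.
  exact: cst_continuous.
have -> : (fun z : K^o => (p * 'X + c%:P).[z] : K^o) = (fun z => p.[z] * z + c).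
  by apply/funext => x; rewrite hornerMXaddC.
exact: (cvgD (cvgM (IHp z) cvg_id) (@cst_continuous _ _ c z)).
Qed.

(** A convergent factor is eventually bounded, so multiplying by it only enlarges the constant of
    the big-O. *)
Lemma eqO_cvg_mul {K : numFieldType} {T : Type} {F : filter_on T}
    {e f g h : T -> K^o} {l : K^o} :
  f =O_F e -> (g x @[x --> F] --> l)%classic ->
  (\forall x \near F, h x = g x * f x) -> h =O_F e.
Proof.
move=> /eqO_exP[c c_gt0 fe] gl hgf; apply/eqO_exP.
(* Any bound strictly above the norm of the limit [l] holds eventually for [g]; the added 1 also
   keeps the constant positive when [l = 0]. *)
exists ((`|l| + 1) * c); first by rewrite mulr_gt0// ltr_wpDl.
have gb : \forall x \near F, `|g x| < `|l| + 1.
  by apply: (cvgr_norm_lt _ gl); rewrite ltrDl.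
near=> x.
have -> : h x = g x * f x by near: x.
rewrite normrM -mulrA ler_pM//; first by apply: ltW; near: x.
by near: x.
Unshelve. all: by end_near.
Qed.

Lemma eqO_invB {K : numFieldType} {C e : K^o -> K^o} {p q : {poly K}} {a : K^o} :
  {for a, continuous C} -> C a != 0 -> p.[a] != 0 -> q.[a] != 0 ->
  (fun z : K^o => C z - p.[z] / q.[z] : K^o) =O_ a e ->
  (fun z : K^o => (C z)^-1 - q.[z] / p.[z] : K^o) =O_ a e.
Proof.
move=> Ccont Ca pa qa CO.
have pC : (p.[z] * C z @[z --> a] --> (p.[a] * C a : K^o))%classic.
  exact: (cvgM (@continuous_horner K p a) Ccont).
have pCa : p.[a] * C a != 0 by rewrite mulf_neq0.
apply: (eqO_cvg_mul (g := fun z : K^o => - (q.[z] / (p.[z] * C z)) : K^o) CO).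
  exact: (cvgN (cvgM (@continuous_horner K q a) (cvgV pCa pC))).
(* The identity relating the two errors needs [p], [q] and [C] nonzero, as division by zero returns
   0. By continuity, nonvanishing at [a] extends to a neighbourhood. *)
have near_neq0 (r : {poly K}) : r.[a] != 0 -> \forall z \near a, r.[z] != 0.
  exact: (cvgr_neq0 _ (@continuous_horner K r a)).
have p_neq0 := near_neq0 p pa.
have q_neq0 := near_neq0 q qa.
have C_neq0 : \forall z \near a, C z != 0 by exact: (cvgr_neq0 _ Ccont Ca).
near=> z.
have pz : p.[z] != 0 by near: z.
have qz : q.[z] != 0 by near: z.
have Cz : C z != 0 by near: z.
by field; rewrite pz Cz qz.
Unshelve. all: by end_near.
Qed.

Section ComplexReciprocal.
Variable R : realType.
Implicit Types (z : R[i]) (r : nat -> R[i]).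

Lemma Re_gt0_neq0 z : 0 < complex.Re z -> z != 0.
Proof. by apply: contraTneq => ->; rewrite ltxx. Qed.

(** For [z = a + ib], the inverse has real part [a / (a ^+ 2 + b ^+ 2)]. *)
Lemma Re_inv_gt0 z : 0 < complex.Re z -> 0 < complex.Re z^-1.
Proof.
case: z => a b /= a_gt0.
by rewrite divr_gt0// ltr_pwDl ?sqr_ge0// exprn_gt0.
Qed.

(** Both sequences obey the same recurrences, so only signs and initial values matter. At even
    indices the sign of [r n] cancels that of the preceding odd term; at odd indices [r n] and the
    preceding odd term both flip the sign, while [1 - |r n|^2] is unchanged. The factor [r0^-1]
    matches the initial values [r0] and 1. The odd cases are there to carry the induction. *)
Lemma ppc_opp (r0 : R) (r s : nat -> R[i]) :
  0 < r0 -> (forall n, (1 <= n)%N -> s n = - r n) -> forall n,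
  [/\ ppc_numer r0^-1 s n.*2 = (r0^-1)%:C *: ppc_denom r0 r n.*2,
      ppc_denom r0^-1 s n.*2 = (r0^-1)%:C *: ppc_numer r0 r n.*2,
      ppc_numer r0^-1 s n.*2.+1 = - ((r0^-1)%:C *: ppc_denom r0 r n.*2.+1) &
      ppc_denom r0^-1 s n.*2.+1 = - ((r0^-1)%:C *: ppc_numer r0 r n.*2.+1)].
Proof.
move=> r0_gt0 sr; elim=> [|n [IH1 IH2 IH3 IH4]].
  have [-> -> -> ->] := ppc_initial r0 r.
  have [-> -> -> ->] := ppc_initial r0^-1 s.
  have r0V : (r0^-1)%:C * r0%:C = 1 :> R[i].
    by rewrite fmorphV mulVf// fmorph_eq0 gt_eqF.
  split; first by rewrite alg_polyC.
  - by rewrite scale_polyC r0V.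
  - by rewrite alg_polyC polyCN.
  - by rewrite scale_polyC mulrN r0V polyCN opprK.
have [Pe Po] := ppc_numer_rec r0 r (ltn0Sn n).
have [Qe Qo] := ppc_denom_rec r0 r (ltn0Sn n).
have [Pe' Po'] := ppc_numer_rec r0^-1 s (ltn0Sn n).
have [Qe' Qo'] := ppc_denom_rec r0^-1 s (ltn0Sn n).
have sn : s n.+1 = - r n.+1 := sr n.+1 isT.
have EP : ppc_numer r0^-1 s n.+1.*2 = (r0^-1)%:C *: ppc_denom r0 r n.+1.*2.
  rewrite Pe' Qe doubleS /= IH3 IH1 sn rmorphN.
  by rewrite scaleNr mulrNN -scalerAr scalerDr.
have EQ : ppc_denom r0^-1 s n.+1.*2 = (r0^-1)%:C *: ppc_numer r0 r n.+1.*2.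
  rewrite Qe' Pe doubleS /= IH4 IH2 sn rmorphN.
  by rewrite scaleNr mulrNN -scalerAr scalerDr.
split; [exact: EP|exact: EQ| |].
  rewrite Po' Qo EP sn normrN doubleS /= IH3 polyCN.
  by rewrite mulNr mulrN -!scalerAr -opprD -scalerDr.
rewrite Qo' Po EQ sn normrN doubleS /= IH4 polyCN.
by rewrite mulNr mulrN -!scalerAr -opprD -scalerDr.
Qed.

(** Each even step adds a multiple of ['X] to the previous even term, so the constant coefficient
    stays at its initial value. *)
Lemma ppc_even_at0 (r0 : R) r n :
  (ppc_numer r0 r n.*2).[0] = r0%:C /\ (ppc_denom r0 r n.*2).[0] = 1.
Proof.
elim: n => [|n [IHP IHQ]].
  by have [-> -> _ _] := ppc_initial r0 r; rewrite !hornerC.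
have at0 (c : R[i]) (p q : {poly R[i]}) : (c *: 'X * p + q).[0] = q.[0].
  by rewrite hornerD hornerM hornerZ hornerX mulr0 mul0r add0r.
have [Pe _] := ppc_numer_rec r0 r (ltn0Sn n).
have [Qe _] := ppc_denom_rec r0 r (ltn0Sn n).
by split; [rewrite Pe at0; exact: IHP|rewrite Qe at0; exact: IHQ].
Qed.

Lemma caratheodory_of_ppc_inv {r0 : R} {r s : nat -> R[i]} {C : R[i] -> R[i]} :
  (forall n, (1 <= n)%N -> s n = - r n) ->
  caratheodory_of_ppc r0 r C ->
  caratheodory_of_ppc r0^-1 s (fun z => (C z)^-1).
Proof.
move=> sr [[r0_gt0 r_lt1] C_an C_Re C_O]; split.
- by split=> [|n n_gt0]; [rewrite invr_gt0|rewrite sr// normrN r_lt1].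
- move=> z z_lt1; apply: derivableV; last exact: C_an.
  exact/Re_gt0_neq0/C_Re.
- by move=> z z_lt1; exact/Re_inv_gt0/C_Re.
move=> n.
have [P0 Q0] := ppc_even_at0 r0 r n.
have [PQ QP _ _] := ppc_opp r0 r s r0_gt0 sr n.
have r0C : (r0^-1)%:C != 0 :> R[i] by rewrite fmorph_eq0 invr_eq0 gt_eqF.
have disk0 : `|0 : R[i]| < 1 by rewrite normr0.
(* Only the nonzero constant [r0^-1] is cancelled, so the two functions agree at every [z], zeros of
   the numerator included. *)
have -> : (fun z : R[i]^o => (C z)^-1 -
    (ppc_numer r0^-1 s n.*2).[z] / (ppc_denom r0^-1 s n.*2).[z] : R[i]^o) =
  (fun z => (C z)^-1 - (ppc_denom r0 r n.*2).[z] / (ppc_numer r0 r n.*2).[z]).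
  rewrite PQ QP; move: (ppc_denom _ _ _) (ppc_numer _ _ _) => q p.
  by apply/funext => z; rewrite !hornerZ -mulf_div divff// mul1r.
apply: (eqO_invB _ _ _ _ (C_O n)).
- exact/differentiable_continuous/derivable1_diffP/C_an.
- exact/Re_gt0_neq0/C_Re.
- by rewrite P0 fmorph_eq0 gt_eqF.
- by rewrite Q0 oner_neq0.
Qed.

End ComplexReciprocal.

Theorem theorem3p2 (R : realType) (delta m k : nat -> R)
  (hdelta0 : 0 < delta 0%N)
  (hdelta1 : forall n : nat, (1 <= n)%N -> `|delta n| < 1)
  (hdelta : forall n : nat, (2 <= n)%N ->
     delta n - delta n.-1 = delta n.-1 * delta n)
  (hm0 : m 0%N = 0)
  (hm : forall n : nat, (1 <= n)%N -> m n = (1 - delta n) / 2)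
  (hk0 : k 0%N = 0)
  (hk : forall n : nat, (1 <= n)%N -> k n = 1 - m n)
  (C : R[i] -> R[i])
  (hC : caratheodory_of_parameters m C) :
  caratheodory_of_parameters k (fun z : R[i] => (C z)^-1).
Proof.
case: hC => -[_ m01] hC; split.
  split=> // n n_gt0; have /andP[m_gt0 m_lt1] := m01 n n_gt0.
  by rewrite hk// subr_gt0 m_lt1 ltrBlDr ltrDl.
(* Here [r0 = 1] is its own inverse, and [1 - 2 k_n = - (1 - 2 m_n)] gives the sign change of the
   parameters. *)
rewrite -(invr1 R); apply: caratheodory_of_ppc_inv hC => n n_gt0.
by rewrite /ppc_of_parameters hk// -rmorphN; congr (_%:C); ring.
Qed.
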